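(* Let $q\in\mathbb{C}$ with $0<|q|<1$. The $q$-exponential function with parameter $\alpha$ satisfies $$\mathcal{E}_{q,\alpha(q)}(z)=\mathcal{E}_{q^{-1},\alpha(q^{-1})}(z)$$ (as power series in $z$) if and only if $$q^{\binom{n}{2}}\,\alpha(q^{-1},n)=\alpha(q,n)\quad\text{for all integers } n\ge 0.$$
   Context: For $p\ne 1$, $[n]_p=\frac{1-p^n}{1-p}$, and $[n]_p!=[1]_p[2]_p\cdots[n]_p$ with $[0]_p!=1$. The parameter $\alpha(q,n)$ is a complex-valued function of $q$ and of the integer $n\ge0$ (defined also with $q$ replaced by $q^{-1}$), with $\alpha(q,n)\to 1$ as $q\to 1^-$. The unified $q$-exponential function is $$\mathcal{E}_{q,\alpha(q)}(z)=\mathcal{E}_{q,\alpha}(z)=\sum_{n=0}^{\infty}\frac{z^n}{[n]_q!}\,\alpha(q,n),$$ and $$\mathcal{E}_{q^{-1},\alpha(q^{-1})}(z)=\sum_{n=0}^{\infty}\frac{z^n}{[n]_{q^{-1}}!}\,\alpha(q^{-1},n).$$ *)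

(* Defs.v *)
(* The complex numbers are R[i], where R : realType is the field of reals. *)
From mathcomp Require Export all_boot all_order all_algebra.
From mathcomp Require Export all_classical all_reals all_analysis.
From mathcomp Require Export complex.
Export Order.TTheory GRing.Theory Num.Theory.
Export numFieldNormedType.Exports.

Set Implicit Arguments.
Unset Strict Implicit.
Unset Printing Implicit Defensive.

Local Open Scope ring_scope.

(* Meaningful for p != 1 only; at p = 1 the quotient takes the value 0. *)
Definition qnum (K : fieldType) (p : K) (n : nat) : K :=
  (1 - p ^+ n) / (1 - p).

Definition qfact (K : fieldType) (p : K) (n : nat) : K :=
  \prod_(1 <= k < n.+1) qnum p k.

(* A formal power series \sum_n (c n) z^n in one indeterminate z is its
   sequence of coefficients; no convergence is involved. *)
Definition fps (K : Type) : Type := nat -> K.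

(* The series \sum_n (z^n / [n]_p!) (a n): the parameter is the sequence
   a n = alpha(p, n), so that E_{q, alpha(q)} is [unified_qexp q (alpha q)]. *)
Definition unified_qexp (K : fieldType) (p : K) (a : nat -> K) : fps K :=
  fun n => (qfact p n)^-1 * a n.

(* Main.v *)
Require Import Defs.

Set Implicit Arguments.
Unset Strict Implicit.
Unset Printing Implicit Defensive.

Local Open Scope classical_set_scope.
Local Open Scope ring_scope.
Local Open Scope complex_scope.

(** Inverting the base rescales a q-number by a power of q, namely
    [k]_q = q^(k-1) [k]_(1/q), and the exponents 0 + 1 + ... + (n-1) add up to
    'C(n, 2) in the q-factorial ([qfactV]).  Hence the n-th coefficient of the
    q-exponential in base 1/q is q^'C(n, 2) alpha(1/q, n) / [n]_q!
    ([unified_qexpV]).  Both series thus have the denominator [n]_q! in degree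
    n; it is nonzero because |q| < 1 keeps q from being a root of unity
    ([qfact_neq0]), so comparing coefficients amounts to comparing
    numerators. *)

(** Multiply the numerator and the denominator of [k+1]_(1/q) by - q^(k+1) and
    by - q respectively.  At q = 1 both sides are 0 by the convention on
    division by zero. *)
Lemma qnumV (K : fieldType) (q : K) (k : nat) :
  q != 0 -> q ^+ k * qnum q^-1 k.+1 = qnum q k.+1.
Proof.
move=> q0; rewrite /qnum.
have -> : (1 - q^-1)^-1 = q * - (1 - q)^-1.
  by rewrite -[- (1 - q)^-1]invrN opprB -{2}[q]invrK -invfM mulrBr mulr1 mulVf.
rewrite exprVn mulrA mulrACA -exprSr mulrA mulrBr mulr1.
by rewrite divff ?expf_neq0 // mulrN -mulNr opprB.
Qed.

Lemma qfactS (K : fieldType) (q : K) (n : nat) :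
  qfact q n.+1 = qfact q n * qnum q n.+1.
Proof. by rewrite /qfact big_nat_recr. Qed.

Lemma qfactV (K : fieldType) (q : K) (n : nat) :
  q != 0 -> q ^+ 'C(n, 2) * qfact q^-1 n = qfact q n.
Proof.
move=> q0; elim: n => [|n IHn].
  by rewrite expr0 mul1r /qfact !big_geq.
by rewrite !qfactS binS bin1 exprD mulrACA IHn qnumV.
Qed.

Lemma qfact_neq0 (K : fieldType) (q : K) (n : nat) :
  (forall k : nat, q ^+ k.+1 != 1) -> qfact q n != 0.
Proof.
move=> q_nroot; elim: n => [|n IHn].
  by rewrite /qfact big_geq // oner_eq0.
rewrite qfactS mulf_neq0 // /qnum mulf_neq0 ?invr_eq0 // subr_eq0 eq_sym //.
by rewrite -[q]expr1.
Qed.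

Lemma unified_qexpV (K : fieldType) (q : K) (a : nat -> K) (n : nat) :
  q != 0 ->
  unified_qexp q^-1 a n = (qfact q n)^-1 * (q ^+ 'C(n, 2) * a n).
Proof.
move=> q0; rewrite /unified_qexp -(qfactV n q0) invfM mulrA; congr (_ * _).
by rewrite mulrAC mulVf ?mul1r // expf_neq0.
Qed.

Theorem lemma5 (R : realType) (alpha : R[i] -> nat -> R[i])
    (alpha_lim : forall n : nat,
      (alpha x%:C n : R[i]^o) @[x --> (1 : R)^'-] --> (1 : R[i]^o))
    (q : R[i]) (q_gt0 : 0 < `|q|) (q_lt1 : `|q| < 1) :
  unified_qexp q (alpha q) = unified_qexp q^-1 (alpha q^-1) <->
  (forall n : nat, q ^+ 'C(n, 2) * alpha q^-1 n = alpha q n).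
Proof.
have q0 : q != 0 by rewrite -normr_gt0.
have q_nroot k : q ^+ k.+1 != 1.
  apply/eqP => qk1; have := exprn_ilt1 k.+1 (normr_ge0 q) q_lt1.
  by rewrite -normrX qk1 normr1 ltxx.
split=> [eqE n | eq_alpha].
  have := congr1 (fun c => c n) eqE; rewrite /= unified_qexpV // => eq_coef.
  by apply: (mulfI (invr_neq0 (qfact_neq0 n q_nroot))); rewrite -eq_coef.
by apply/funext => n; rewrite unified_qexpV // eq_alpha.
Qed.
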